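(* Let $G$ be a finite group, let $1\le n<m$, let $w_1=w_1(x_1,\dots,x_n)$ and $w_2=w_2(x_{n+1},\dots,x_m)$ be words, and let $w(x_1,\dots,x_m)=[w_1(x_1,\dots,x_n),w_2(x_{n+1},\dots,x_m)]$. If $\zeta^{w_1}_G$ is a character of $G$ and the word $w_2$ is measure preserving with respect to $G$, then $\zeta^w_G$ is a character of $G$ and $$\zeta^w_G=\sum_{\chi\in\mathrm{Irr}(G)}\frac{|G|^{m-n}}{\chi(1)}\,\langle \zeta^{w_1}_G\chi,\chi\rangle\,\chi .$$
   Context: Characters are ordinary complex characters; $\mathrm{Irr}(G)$ is the set of irreducible characters of $G$; $\langle\phi,\psi\rangle=\frac1{|G|}\sum_{g\in G}\phi(g)\overline{\psi(g)}$. $[a,b]=a^{-1}b^{-1}ab$. A word in $k$ variables is a non-trivial reduced element of the free group on these variables. For a word $v$ in $k$ variables, $\zeta^v_G(g)=|\{(a_1,\dots,a_k)\in G^k : v(a_1,\dots,a_k)=g\}|$ for $g\in G$. A word $v$ is measure preserving with respect to $G$ if all fibers of the map $v:G^k\to G$ have equal size, i.e. $\zeta^v_G$ is constant on $G$. *)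

(* Defs.v *)
From HB Require Import structures.
From mathcomp Require Import all_boot all_order all_fingroup all_algebra.
From mathcomp Require Import all_solvable all_field all_character.

Set Implicit Arguments.
Unset Strict Implicit.
Unset Printing Implicit Defensive.

Import GroupScope.

(* The free group on T, as the type of reduced sequences of letters;
   (x, false) is the generator x and (x, true) its inverse. *)
Section FreeGroup.

Variable T : choiceType.
Implicit Types (l : T * bool) (s t : seq (T * bool)).

Definition letter_inv l := (l.1, ~~ l.2).

Definition reduced s := sorted (fun l l' => l' != letter_inv l) s.

Definition push l s :=
  if s is l' :: s' then if l' == letter_inv l then s' else l :: s else [:: l].

Definition reduce s := foldr push [::] s.

Definition inv_seq s := rev (map letter_inv s).

Lemma letter_invK : involutive letter_inv.
Proof. by case=> x b; rewrite /letter_inv /= negbK. Qed.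

Lemma letter_inv_neq l : l != letter_inv l.
Proof. by case: l => x b; rewrite xpair_eqE eqxx /=; case: b. Qed.

Lemma push_reduced l s : reduced s -> reduced (push l s).
Proof.
case: s => [//|l' s] /= rs; case: eqP => [_|/eqP l'l].
  exact: path_sorted rs.
by rewrite /= l'l.
Qed.

Lemma reduce_reduced s : reduced (reduce s).
Proof. by elim: s => //= l s IHs; apply: push_reduced. Qed.

Lemma reduce_id s : reduced s -> reduce s = s.
Proof.
elim: s => //= l s IHs rs; rewrite IHs; last exact: path_sorted rs.
by case: s rs {IHs} => //= l' s /andP[/negbTE->].
Qed.

Lemma pushK l s : reduced s -> push l (push (letter_inv l) s) = s.
Proof.
case: s => [|l' s] /=; first by rewrite eqxx.
rewrite letter_invK; case: (l' =P l) => [->|_] /= rs; last by rewrite eqxx.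
by case: s rs => //= l'' s /andP[/negbTE->].
Qed.

Lemma reduce_push l s t : reduce (push l s ++ t) = push l (reduce (s ++ t)).
Proof.
case: s => //= l' s; case: eqP => //= ->.
by rewrite pushK // reduce_reduced.
Qed.

Lemma reduce_catl s t : reduce (reduce s ++ t) = reduce (s ++ t).
Proof. by elim: s => //= l s IHs; rewrite reduce_push IHs. Qed.

Lemma reduce_catr s t : reduce (s ++ reduce t) = reduce (s ++ t).
Proof.
by elim: s => [|l s /= -> //]; rewrite /= reduce_id ?reduce_reduced.
Qed.

Lemma inv_seq_reduced s : reduced s -> reduced (inv_seq s).
Proof.
rewrite /reduced /inv_seq rev_sorted sorted_map.
apply: sub_sorted => l l' /=; apply: contraNneq => ->.
by rewrite !letter_invK.
Qed.

Lemma inv_seqK : involutive inv_seq.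
Proof. by move=> s; rewrite /inv_seq map_rev revK (mapK letter_invK). Qed.

Lemma reduce_seqV s : reduce (s ++ inv_seq s) = [::].
Proof.
elim: s => //= l s IHs; rewrite /inv_seq /= rev_cons -cats1 catA.
by rewrite -reduce_catl IHs /= eqxx.
Qed.

Record free_group := FreeGroup { letters :> seq (T * bool); _ : reduced letters }.

HB.instance Definition _ := [isSub for letters].
HB.instance Definition _ := [Choice of free_group by <:].

Implicit Types u v w : free_group.

Definition fg_one := @FreeGroup [::] isT.
Definition fg_inv w := FreeGroup (inv_seq_reduced (valP w)).
Definition fg_mul u v := FreeGroup (reduce_reduced (u ++ v)).
Definition fg_gen (x : T) := @FreeGroup [:: (x, false)] isT.

Lemma fg_mulA : associative fg_mul.
Proof.
by move=> u v w; apply: val_inj; rewrite /= reduce_catl reduce_catr catA.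
Qed.

Lemma fg_mul1 : left_id fg_one fg_mul.
Proof. by move=> w; apply: val_inj; rewrite /= reduce_id //; case: w. Qed.

Lemma fg_mulr1 : right_id fg_one fg_mul.
Proof. by move=> w; apply: val_inj; rewrite /= cats0 reduce_id //; case: w. Qed.

Lemma fg_mulrV : right_inverse fg_one fg_inv fg_mul.
Proof. by move=> w; apply: val_inj; rewrite /= reduce_seqV. Qed.

Lemma fg_mulV : left_inverse fg_one fg_inv fg_mul.
Proof.
move=> w; apply: val_inj => /=.
by rewrite -[X in _ ++ X]inv_seqK reduce_seqV.
Qed.

HB.instance Definition _ :=
  isGroup.Build free_group fg_mulA fg_mul1 fg_mulr1 fg_mulV fg_mulrV.

(* The value w(a) of a word w at a, in any group: the image of w under the
   homomorphism extending a. *)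
Definition word_eval (gT : groupType) (a : T -> gT) (w : free_group) : gT :=
  \prod_(l <- letters w) (if l.2 then (a l.1)^-1 else a l.1).

Lemma word_eval_gen (gT : groupType) (a : T -> gT) x :
  word_eval a (fg_gen x) = a x.
Proof. by rewrite /word_eval big_seq1. Qed.

Lemma word_evalM (gT : groupType) (a : T -> gT) u v :
  word_eval a (u * v) = word_eval a u * word_eval a v.
Proof.
rewrite /word_eval -big_cat /=; elim: (u ++ v) => //= l s IHs.
rewrite big_cons -IHs; case: (reduce s) => [|l' t] /=; first by rewrite big_cons.
case: eqP => [-> | _]; last by rewrite big_cons.
by rewrite big_cons /=; case: l.2; rewrite /= ?mulKg ?mulVKg.
Qed.

End FreeGroup.

Definition rename_vars (S T : choiceType) (f : S -> T) (w : free_group S) :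
  free_group T := word_eval (fun x => fg_gen (f x)) w.

Notation word_in k := (free_group 'I_k).

Definition is_word (k : nat) (w : word_in k) := w != 1.

Section Fibers.

Variables (gT : finGroupType) (G : {group gT}) (k : nat).
Implicit Types (v : word_in k) (g : gT).

Definition fiber_size v g :=
  #|[set a : {ffun 'I_k -> gT} | (a \in ffun_on G) && (word_eval a v == g)]|.

Definition measure_preserving v := {in G &, forall g h, fiber_size v g = fiber_size v h}.

Lemma word_evalJ v (a : 'I_k -> gT) x :
  word_eval (fun i => a i ^ x) v = word_eval a v ^ x.
Proof.
rewrite /word_eval; elim: (letters v) => [|l s IHs].
  by rewrite !big_nil conj1g.
by rewrite !big_cons conjMg IHs; case: l.2; rewrite ?conjVg.
Qed.

Lemma eq_word_eval v (a b : 'I_k -> gT) :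
  a =1 b -> word_eval a v = word_eval b v.
Proof. by move=> ab; apply: eq_bigr => l _; rewrite ab. Qed.

Lemma word_eval_in v (a : 'I_k -> gT) :
  (forall i, a i \in G) -> word_eval a v \in G.
Proof.
by move=> Ga; apply: group_prod => l _; case: l.2; rewrite ?groupV.
Qed.

Lemma fiber_size_notin v g : g \notin G -> fiber_size v g = 0%N.
Proof.
move=> notGg; apply: eq_card0 => a; rewrite inE.
apply/negP=> /andP[/ffun_onP Ga /eqP def_g].
by rewrite -def_g word_eval_in in notGg.
Qed.

Lemma fiber_sizeJ v g x : x \in G -> fiber_size v (g ^ x) = fiber_size v g.
Proof.
move=> Gx; pose J (y : gT) (a : {ffun 'I_k -> gT}) := [ffun i => a i ^ y].
have JK y : cancel (J y) (J y^-1).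
  by move=> a; apply/ffunP=> i; rewrite !ffunE conjgK.
rewrite /fiber_size -[RHS](card_imset _ (can_inj (JK x))); apply: eq_card => b.
rewrite inE; apply/idP/imsetP => [/andP[/ffun_onP Gb /eqP vb] | [a]].
  exists (J x^-1 b); last by have:= JK x^-1 b; rewrite invgK.
  rewrite inE; apply/andP; split.
    by apply/ffun_onP=> i; rewrite ffunE groupJ ?groupV.
  rewrite (@eq_word_eval _ _ (fun i => b i ^ x^-1)) => [|i]; last exact: ffunE.
  by rewrite word_evalJ vb conjgK.
rewrite inE => /andP[/ffun_onP Ga /eqP <-] ->; apply/andP; split.
  by apply/ffun_onP=> i; rewrite ffunE groupJ.
rewrite (@eq_word_eval _ _ (fun i => a i ^ x)) => [|i]; last exact: ffunE.
by rewrite word_evalJ.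
Qed.

Fact zeta_subproof v : is_class_fun <<G>> [ffun g => (fiber_size v g)%:R%R].
Proof.
rewrite genGid; apply: intro_class_fun => [g x _ Gx | g notGg].
  by rewrite fiber_sizeJ.
by rewrite fiber_size_notin.
Qed.

Definition zeta v : 'CF(G) := Cfun 0 (zeta_subproof v).

Lemma zetaE v g : zeta v g = (fiber_size v g)%:R%R.
Proof. by rewrite cfunElock. Qed.

End Fibers.

Section CommutatorWord.

Variables (n m : nat) (le_n_m : n <= m).

(* The variables of the second word are x_(n+1), ..., x_m, those of the first
   x_1, ..., x_n (numbered from 0 below). *)
Definition first_var : 'I_n -> 'I_m := widen_ord le_n_m.
Definition last_var (i : 'I_(m - n)) : 'I_m :=
  cast_ord (subnKC le_n_m) (rshift n i).

Definition comm_word (w1 : word_in n) (w2 : word_in (m - n)) : word_in m :=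
  [~ rename_vars first_var w1, rename_vars last_var w2].

End CommutatorWord.

(* Main.v *)
(* If y is uniformly distributed on G then, by Schur's lemma, the average of
   chi [x, y] = chi (x^-1 x^y) is |chi x|^2 / chi 1.  Since w_2 is measure
   preserving, averaging over the values of w_1 and w_2 gives
   <zeta_w, chi> = |G|^(m-n) / chi 1 * <zeta_(w_1) chi, chi>, a natural number
   because chi 1 divides |G| and m - n > 0. *)
Require Import Defs.
From HB Require Import structures.
From mathcomp Require Import all_boot all_order all_fingroup all_algebra.
From mathcomp Require Import all_solvable all_field all_character.
Import GRing.Theory Num.Theory.
Local Open Scope ring_scope.

Section WordEval.

Variables (T : choiceType) (gT : groupType) (a : T -> gT).
Implicit Types u v : free_group T.

Lemma word_eval1 : word_eval a (1%g : free_group T) = 1%g.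
Proof. by rewrite /word_eval big_nil. Qed.

Lemma word_evalV u : word_eval a u^-1%g = (word_eval a u)^-1%g.
Proof.
by apply: (mulIg (word_eval a u)); rewrite -word_evalM !mulVg word_eval1.
Qed.

Lemma word_evalR u v :
  word_eval a [~ u, v]%g = [~ word_eval a u, word_eval a v]%g.
Proof. by rewrite /commg /conjg !(word_evalM, word_evalV). Qed.

Lemma word_eval_rename (S : choiceType) (f : S -> T) (w : free_group S) :
  word_eval a (rename_vars f w) = word_eval (a \o f) w.
Proof.
rewrite /rename_vars {2 3}/word_eval.
elim: (letters w) => [|l s IHs]; first by rewrite !big_nil word_eval1.
by rewrite !big_cons word_evalM IHs; case: l.2; rewrite ?word_evalV word_eval_gen.
Qed.

End WordEval.

Section Zeta.

Variables (gT : finGroupType) (G : {group gT}).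

(** Group the tuples of [G] by the value that [v] takes on them. *)
Lemma sum_fiber_size (R : nzSemiRingType) k (v : word_in k) (F : gT -> R) :
  \sum_(g in G) (fiber_size G v g)%:R * F g
    = \sum_(a : {ffun 'I_k -> gT} | a \in ffun_on G) F (word_eval a v).
Proof.
rewrite [RHS](partition_big (fun a : {ffun _ -> _} => word_eval a v) (mem G)).
  apply: eq_bigr => g _; rewrite (eq_bigr (fun=> F g)); last first.
    by move=> a /andP[_ /eqP->].
  by rewrite sumr_const mulr_natl; congr (_ *+ _); apply: eq_card => a; rewrite inE.
by move=> a /ffun_onP Ga; apply: word_eval_in.
Qed.

(** The [#|G|] fibers have a common size and together exhaust the [#|G| ^ k] tuples; this is
    [sum_fiber_size] at the constant function 1. *)
Lemma measure_preserving_fiber_size k (v : word_in k) g :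
  measure_preserving G v -> g \in G ->
  (fiber_size G v g)%:R * #|G|%:R = #|G|%:R ^+ k :> algC.
Proof.
move=> v_mp Gg; have := @sum_fiber_size algC k v (fun=> 1).
rewrite (eq_bigr (fun=> (fiber_size G v g)%:R)); last first.
  by move=> h Gh; rewrite mulr1 (v_mp h g).
by rewrite !sumr_const card_ffun_on card_ord mulr_natr natrX.
Qed.

(** Schur's lemma: the sum [A] of [rG (z ^ y)] over [y] commutes with the representation [rG]
    affording ['chi_i], so it is a scalar [c]. The traces of [rG x *m A] and of [A] give two
    equations, from which [c] is eliminated. *)
Lemma sum_irr_mulJ i x z : x \in G -> z \in G ->
  \sum_(y in G) 'chi[G]_i (x * z ^ y)%g
    = #|G|%:R * ('chi_i x * 'chi_i z) / 'chi_i 1%g.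
Proof.
move=> Gx Gz; apply: (canRL (mulfK (irr1_neq0 i))).
pose rG := 'Chi_i; pose A := \sum_(y in G) rG (z ^ y)%g.
have /is_scalar_mxP[c cA]: is_scalar_mx A.
  have absG: mx_absolutely_irreducible rG by exact/groupC/socle_irr.
  apply: (mx_abs_irr_cent_scalar absG).
  apply/centgmxP => y Gy; rewrite mulmx_suml mulmx_sumr.
  (* Replacing [t] by [t * y] on the right matches the terms, since
     [z ^ t * y = y * z ^ (t * y)]. *)
  rewrite [RHS](reindex_acts 'R _ Gy) ?astabsR //=; apply: eq_bigr => t Gt.
  by rewrite -!repr_mxM ?groupJ ?groupM // conjgM -conjgC.
have trE (y : gT) : y \in G -> 'chi_i y = \tr (rG y).
  by move=> Gy; rewrite -irrRepr cfunE Gy.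
have chi1 : 'chi_i 1%g = (irr_degree (socle_of_Iirr i))%:R.
  by rewrite -irrRepr cfRepr1.
have sum_x : \sum_(y in G) 'chi_i (x * z ^ y)%g = c * 'chi_i x.
  rewrite (trE x) // -mxtraceZ -mul_mx_scalar -cA mulmx_sumr raddf_sum.
  apply: eq_bigr => y Gy; have Gzy : (z ^ y)%g \in G by rewrite groupJ.
  by rewrite (trE _ (groupM Gx Gzy)) repr_mxM.
have sum_z : #|G|%:R * 'chi_i z = c * 'chi_i 1%g.
  have := congr1 mxtrace cA; rewrite mxtrace_scalar chi1 mulr_natr => <-.
  rewrite raddf_sum mulr_natl -sumr_const; apply: eq_bigr => y Gy /=.
  by rewrite -trE ?groupJ // cfunJ.
by rewrite sum_x mulrAC -sum_z -mulrA (mulrC ('chi_i z)).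
Qed.

(** The case of [sum_irr_mulJ] with [x^-1] for [x] and [x] for [z], as [[~ x, y]] is
    [x^-1 * x ^ y]. *)
Lemma sum_irr_commg i x : x \in G ->
  \sum_(y in G) 'chi[G]_i [~ x, y]%g
    = #|G|%:R * ('chi_i x * ('chi_i x)^*) / 'chi_i 1%g.
Proof. by move=> Gx; rewrite sum_irr_mulJ ?groupV // irr_inv (mulrC (_^*)). Qed.

(** The two words have disjoint variables, so an [m]-tuple is an independent choice of an [n]-tuple
    for [w1] and an [(m - n)]-tuple for [w2]. The mutually inverse maps [glue] and [cut] realize
    this. *)
Lemma sum_comm_word (R : nzSemiRingType) n m (le_n_m : (n <= m)%N)
    (w1 : word_in n) (w2 : word_in (m - n)) (F : gT -> R) :
  \sum_(g in G) (fiber_size G (comm_word le_n_m w1 w2) g)%:R * F g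
    = \sum_(x in G) (fiber_size G w1 x)%:R *
        \sum_(y in G) (fiber_size G w2 y)%:R * F [~ x, y]%g.
Proof.
rewrite sum_fiber_size.
under [RHS]eq_bigr => x _ do rewrite sum_fiber_size.
rewrite sum_fiber_size pair_big /=.
pose glue (b : {ffun 'I_n -> gT} * {ffun 'I_(m - n) -> gT})
    : {ffun 'I_m -> gT} := [ffun j : 'I_m =>
     match split (cast_ord (esym (subnKC le_n_m)) j) with
     | inl j1 => b.1 j1 | inr j2 => b.2 j2 end].
pose cut (a : {ffun 'I_m -> gT})
    : {ffun 'I_n -> gT} * {ffun 'I_(m - n) -> gT} :=
  ([ffun j => a (first_var le_n_m j)], [ffun j => a (last_var le_n_m j)]).
have firstE j : first_var le_n_m j = cast_ord (subnKC le_n_m) (lshift (m - n) j).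
  exact: val_inj.
have glue_first b j : glue b (first_var le_n_m j) = b.1 j.
  by rewrite firstE ffunE cast_ordK (unsplitK (inl _ j)).
have glue_last b j : glue b (last_var le_n_m j) = b.2 j.
  by rewrite ffunE cast_ordK (unsplitK (inr _ j)).
(* Case analysis on a variable: it belongs either to the first word or to the second. *)
have varsP (P : 'I_m -> Prop) : (forall j, P (first_var le_n_m j)) ->
    (forall j, P (last_var le_n_m j)) -> forall j, P j.
  move=> P1 P2 j; rewrite -(cast_ordKV (subnKC le_n_m) j).
  by case: (split_ordP (cast_ord (esym (subnKC le_n_m)) j)) => k ->;
    rewrite -?firstE; [apply: P1 | apply: P2].
rewrite (reindex glue) /=; last first.
  exists cut => [[b1 b2] _ | a _].
    by congr (_, _); apply/ffunP => j; rewrite ffunE ?glue_first ?glue_last.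
  apply/ffunP; apply: varsP => j; first by rewrite glue_first ffunE.
  by rewrite glue_last ffunE.
apply: eq_big => [b | b _].
  apply/ffun_onP/andP => [Gb | [/ffun_onP Gb1 /ffun_onP Gb2]].
    by split; apply/ffun_onP => j; rewrite -?glue_first -?glue_last.
  by apply: varsP => j; rewrite ?glue_first ?glue_last.
rewrite /comm_word word_evalR !word_eval_rename.
by congr (F [~ _, _]%g); apply: eq_word_eval => j /=.
Qed.

Lemma cfdot_zeta_comm_word n m (le_n_m : (n <= m)%N)
    (w1 : word_in n) (w2 : word_in (m - n)) i :
    measure_preserving G w2 ->
  '[zeta G (comm_word le_n_m w1 w2), 'chi_i]
    = #|G|%:R ^+ (m - n) / 'chi_i 1%g * '[zeta G w1 * 'chi_i, 'chi_i].
Proof.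
move=> w2_mp; have w2E := measure_preserving_fiber_size _ _ _ w2_mp.
rewrite !cfdotE mulrCA; congr (_ * _).
under eq_bigr => g _ do rewrite zetaE.
rewrite sum_comm_word mulr_sumr; apply: eq_bigr => x Gx.
(* The constant fiber size, taken at 1, leaves the sum and absorbs the factor [#|G|] of
   [sum_irr_commg] to form [#|G| ^ (m - n)]. Conjugation is harmless because the average of ['chi_i
   [~ x, y]] is real. *)
have sum_y : \sum_(y in G) (fiber_size G w2 y)%:R * ('chi_i [~ x, y]%g)^*
    = #|G|%:R ^+ (m - n) / 'chi_i 1%g * ('chi_i x * ('chi_i x)^*).
  under eq_bigr => y Gy do rewrite (w2_mp y 1%g) //.
  rewrite -mulr_sumr -rmorph_sum sum_irr_commg // -(w2E 1%g) //.
  rewrite !rmorphM fmorphV /= rmorph_nat conjCK (conj_natr (Cnat_irr1 i)).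
  by rewrite (mulrC (_^*)) !mulrA -!(mulrAC _ ('chi_i 1%g)^-1).
by rewrite sum_y cfunE zetaE -[_ * 'chi_i x * _]mulrA mulrCA.
Qed.

End Zeta.

Theorem corollary2p3 (gT : finGroupType) (G : {group gT}) (n m : nat)
    (n_gt0 : (1 <= n)%N) (lt_n_m : (n < m)%N)
    (w1 : word_in n) (w2 : word_in (m - n))
    (word_w1 : is_word w1) (word_w2 : is_word w2)
    (w := comm_word (ltnW lt_n_m) w1 w2) :
  zeta G w1 \is a character ->
  measure_preserving G w2 ->
  zeta G w \is a character /\
  zeta G w = \sum_(i : Iirr G)
    (#|G|%:R ^+ (m - n) / 'chi_i 1%g * '[zeta G w1 * 'chi_i, 'chi_i]) *: 'chi_i.
Proof.
move=> char_w1 w2_mp.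
have def_w : zeta G w = \sum_(i : Iirr G)
    (#|G|%:R ^+ (m - n) / 'chi_i 1%g * '[zeta G w1 * 'chi_i, 'chi_i]) *: 'chi_i.
  rewrite [LHS]cfun_sum_cfdot; apply: eq_bigr => i _.
  by rewrite cfdot_zeta_comm_word.
split=> //; rewrite def_w; apply: rpred_sum => i _.
(* It suffices that each coefficient is a natural number. Its inner product is one, as both
   [zeta G w1 * 'chi_i] and ['chi_i] are characters. *)
rewrite rpredZ_nat ?irr_char // rpredM //; last first.
  by rewrite Cnat_cfdot_char ?rpredM ?irr_char.
have [q ->] := dvdCP_nat (natr_ge0 (Cnat_irr1 i)) (ler0n _ _) (dvd_irr1_cardG i).
(* With [#|G|] written as [q * 'chi_i 1], one factor is split off the power to cancel the
   denominator. *)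
rewrite -(prednK (_ : 0 < m - n)%N) ?subn_gt0 // exprS mulrAC mulfK ?irr1_neq0 //.
by rewrite rpredM ?rpredX ?rpredM ?natr_nat ?Cnat_irr1.
Qed.
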